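(* Let $G$ be a disconnected graph with exactly one nontrivial connected component $G_1$ and $t > 0$ trivial components, and let $\overline{G}_1$ be the subgraph of $\overline{G}$ induced by the vertices corresponding to $V(G_1)$ (i.e. the complement of $G_1$). If $\mathrm{diam}(\overline{G}_1) \leq 2$, then $h(G\overline{G}) \leq h(\overline{G}_1) + t$.
   Context: All graphs are finite, simple and undirected. For a graph $H$ and $x,y \in V(H)$, the closed interval $I[x,y]$ consists of $x$, $y$ and all vertices lying on some shortest path between $x$ and $y$ in $H$; for $S \subseteq V(H)$, $I[S] = \bigcup_{x,y\in S} I[x,y]$. A set $S$ is (geodetically) convex if $I[S]=S$; the convex hull $H(S)$ is the smallest convex set containing $S$; $S$ is a hull set if $H(S)=V(H)$; the (geodetic) hull number $h(H)$ is the minimum cardinality of a hull set of $H$ (so $h(\overline{G}_1)$ is the hull number of $\overline{G}_1$ as a graph on its own). $\mathrm{diam}$ denotes the diameter. For a graph $G$ with vertex set $\{v_1,\dots,v_n\}$, the complementary prism $G\overline{G}$ has vertex set $\{v_1,\dots,v_n\}\cup\{\overline{v}_1,\dots,\overline{v}_n\}$ and edge set $E(G) \cup \{\overline{v}_i\overline{v}_j : i<j,\ v_iv_j\notin E(G)\} \cup \{v_i\overline{v}_i : 1\le i\le n\}$; $\overline{v}_i$ is the vertex corresponding to $v_i$. A component is trivial if it has exactly one vertex, nontrivial otherwise. *)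

(* Defs.v *)
From HB Require Import structures.
From mathcomp Require Import all_boot.

Set Implicit Arguments.
Unset Strict Implicit.
Unset Printing Implicit Defensive.

Record sgraph := SGraph {
  vertex :> finType;
  adj : rel vertex;
  adj_sym : symmetric adj;
  adj_irr : irreflexive adj }.

Section Constructions.
Variable G : sgraph.

Definition compl_adj : rel G := fun x y => (x != y) && ~~ adj x y.

Fact compl_adj_sym : symmetric compl_adj.
Proof. by move=> x y; rewrite /compl_adj eq_sym adj_sym. Qed.

Fact compl_adj_irr : irreflexive compl_adj.
Proof. by move=> x; rewrite /compl_adj eqxx. Qed.

Definition complement := SGraph compl_adj_sym compl_adj_irr.

Variable A : {set G}.

Definition induced_adj : rel {x : G | x \in A} := fun x y => adj (val x) (val y).

Fact induced_adj_sym : symmetric induced_adj.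
Proof. by move=> x y; apply: adj_sym. Qed.

Fact induced_adj_irr : irreflexive induced_adj.
Proof. by move=> x; apply: adj_irr. Qed.

Definition induced := SGraph induced_adj_sym induced_adj_irr.

End Constructions.

Section ComplementaryPrism.
Variable G : sgraph.

(* [inl v] is the vertex v of G, and [inr v] is the corresponding vertex of
   the complement. *)
Definition cprism_adj : rel (G + G)%type := fun u v =>
  match u, v with
  | inl x, inl y => adj x y
  | inr x, inr y => @adj (complement G) x y
  | inl x, inr y | inr x, inl y => x == y
  end.

Fact cprism_adj_sym : symmetric cprism_adj.
Proof.
by move=> [] x [] y /=; rewrite 1?eq_sym //; [apply: adj_sym|apply: compl_adj_sym].
Qed.

Fact cprism_adj_irr : irreflexive cprism_adj.
Proof. by move=> [] x /=; [apply: adj_irr | apply: compl_adj_irr]. Qed.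

Definition cprism := SGraph cprism_adj_sym cprism_adj_irr.

End ComplementaryPrism.

Section Components.
Variable G : sgraph.

Definition connected : bool := [forall x : G, forall y : G, connect (@adj G) x y].

Definition components : {set {set G}} :=
  equivalence_partition (connect (@adj G)) [set: G].

Definition trivial_components : {set {set G}} :=
  [set C in components | #|C| == 1].

Definition nontrivial_components : {set {set G}} :=
  [set C in components | #|C| != 1].

End Components.

Section Distance.
Variable G : sgraph.
Implicit Types (x y z : G) (p : seq G).

Definition has_walk x y (n : nat) : bool :=
  [exists p : n.-tuple G, path (@adj G) x p && (last x p == y)].

(* [None] stands for infinity. The search is bounded because a shortest walk
   repeats no vertex (see [dist_someP] and [dist_noneP]). *)
Definition dist x y : option nat :=
  let n := find (has_walk x y) (iota 0 #|G|) in
  if n < #|G| then Some n else None.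

(* The vertices of the path are those of [x :: p], and its length is [size p]. *)
Definition geodesic x y p : bool :=
  [&& path (@adj G) x p, last x p == y & dist x y == Some (size p)].

Definition diam : option nat :=
  if connected G then Some (\max_(x : G) \max_(y : G) odflt 0 (dist x y))
  else None.

Definition diam_le (k : nat) : bool := if diam is Some d then d <= k else false.

(* The bound on the length loses no geodesic (see [intervalP]). *)
Definition interval x y : {set G} :=
  [set z | [|| z == x, z == y |
     [exists n : 'I_#|G|, exists p : n.-tuple G,
        geodesic x y p && (z \in x :: p)]]].

Definition interval_set (S : {set G}) : {set G} :=
  \bigcup_(x in S) \bigcup_(y in S) interval x y.

Definition convex (S : {set G}) : bool := interval_set S == S.

Definition hull (S : {set G}) : {set G} :=
  \bigcap_(C : {set G} | convex C && (S \subset C)) C.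

Definition hull_set (S : {set G}) : bool := hull S == [set: G].

(* The full vertex set is a hull set (see [hull_set_setT]), so the minimum is
   attained. *)
Definition hull_number : nat :=
  #|[arg min_(S < [set: G] | hull_set S) #|S|]|.

Lemma has_walkP x y n :
  reflect (exists p, [/\ path (@adj G) x p, last x p = y & size p = n])
          (has_walk x y n).
Proof.
apply: (iffP existsP) => [[p /andP[pp /eqP lp]]|[p [pp lp /eqP sp]]].
  by exists p; rewrite size_tuple.
by exists (Tuple sp); rewrite /= pp lp /=.
Qed.

Lemma has_walk_short x y n :
  has_walk x y n -> exists2 m, m <= n & (m < #|G|) && has_walk x y m.
Proof.
case/has_walkP=> p [pp lp sp].
case: (shortenP pp) lp => q pq uq subq lq; exists (size q).
  by rewrite -sp; apply: uniq_leq_size => //; case/andP: uq.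
apply/andP; split; last by apply/has_walkP; exists q.
by have /card_uniqP/= <- := uq; apply: max_card.
Qed.

Lemma dist_someP x y n :
  reflect (has_walk x y n /\ forall m, has_walk x y m -> n <= m)
          (dist x y == Some n).
Proof.
rewrite /dist; set P := has_walk x y; set s := iota 0 _.
have sz : size s = #|G| by rewrite size_iota.
have nthE i : i < #|G| -> nth 0 s i = i by move=> h; rewrite nth_iota.
apply: (iffP eqP) => [|[Pn minn]].
  case: ifP => // lt_f [<-]; split.
    have := @nth_find _ 0 P s; rewrite has_find sz nthE //; exact.
  move=> m /has_walk_short[k le_km /andP[ltk Pk]].
  apply: leq_trans le_km; rewrite leqNgt; apply/negP => /(before_find 0).
  by rewrite nthE // -/(P k) [P k]Pk.
have [k le_kn /andP[ltk Pk]] := has_walk_short Pn.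
have lt_n : n < #|G| by rewrite (leq_ltn_trans _ ltk) // minn.
suff -> : find P s = n by rewrite lt_n.
apply/eqP; rewrite eqn_leq; apply/andP; split; rewrite leqNgt; apply/negP.
  by move=> /(before_find 0); rewrite nthE // Pn.
move=> lt_f; have lt_fG := ltn_trans lt_f lt_n.
have := @nth_find _ 0 P s; rewrite has_find sz nthE // => /(_ lt_fG)/minn.
by rewrite leqNgt lt_f.
Qed.

Lemma dist_noneP x y : (dist x y == None) = ~~ connect (@adj G) x y.
Proof.
case dxy: (dist x y) => [n|] /=; apply/esym.
  have /dist_someP[/has_walkP[p [pp lp _]] _] : dist x y == Some n by apply/eqP.
  by apply/negbF/connectP; exists p.
apply/negP => /connectP[p pp lp].
have /has_walk_short[k _ /andP[ltk Pk]] : has_walk x y (size p).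
  by apply/has_walkP; exists p.
move: dxy; rewrite /dist; case: ifP => //= /negP[].
suff: has (has_walk x y) (iota 0 #|G|) by rewrite has_find size_iota.
by apply/hasP; exists k; rewrite // mem_iota.
Qed.

Lemma intervalP x y z :
  reflect [\/ z = x, z = y | exists2 p, geodesic x y p & z \in x :: p]
          (z \in interval x y).
Proof.
rewrite inE; apply: (iffP or3P) => [[/eqP|/eqP|]|[->|->|[p gp zp]]].
- by constructor 1.
- by constructor 2.
- by case/existsP=> n /existsP[p /andP[gp zp]]; constructor 3; exists p.
- by constructor 1.
- by constructor 2.
constructor 3; have /and3P[_ _ dp] := gp.
have ltp : size p < #|G|.
  by move: dp; rewrite /dist; case: ifP => // lt_f /eqP[<-].
by apply/existsP; exists (Ordinal ltp); apply/existsP; exists (in_tuple p); apply/andP.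
Qed.

Lemma hull_set_setT : hull_set [set: G].
Proof.
rewrite /hull_set /hull -subTset; apply/bigcapsP => C /andP[_].
by rewrite subTset => /eqP->.
Qed.

End Distance.

(* Main.v *)
Require Import Defs.
From mathcomp Require Import all_boot.

Set Implicit Arguments.
Unset Strict Implicit.
Unset Printing Implicit Defensive.

(** Let [S] be a minimum hull set of the complement of [G1], and [s0] in [S].
    In the complementary prism take [s0] itself on the side of [G], the copies
    of the remaining elements of [S] on the complement side, and the isolated
    vertices of [G].  A geodesic from [s0] to an isolated vertex [u] passes
    through the copies of [s0] and of [u].  As the complement of [G1] has
    diameter at most 2, its geodesics remain geodesics in the prism, so the hull
    contains the whole complement side.  If [v] is in the hull and [w] is a
    neighbour of [v] in [G], then [w] lies on a geodesic from [v] to the copy of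
    [w]; by connectedness of [G1] the hull contains [G1]. *)

(** * Convex sets through geodesics of length two and three *)

Section Convexity.
Variable G : sgraph.
Implicit Types (x y z : G) (C S : {set G}).

Lemma convex_interval C x y z :
  convex C -> x \in C -> y \in C -> z \in interval x y -> z \in C.
Proof.
move=> /eqP CE xC yC zxy; rewrite -CE.
by apply/bigcupP; exists x => //; apply/bigcupP; exists y.
Qed.

Lemma convexI C :
  (forall x y z, x \in C -> y \in C -> z \in interval x y -> z \in C) ->
  convex C.
Proof.
move=> CP; rewrite /convex eqEsubset; apply/andP; split; apply/subsetP=> z.
  by case/bigcupP=> x xC /bigcupP[y yC]; apply: CP.
move=> zC; apply/bigcupP; exists z => //; apply/bigcupP; exists z => //.
by apply/intervalP; constructor 1.
Qed.

Lemma has_walk0 x y : has_walk x y 0 -> x = y.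
Proof. by case/has_walkP=> -[|a p] [] //=. Qed.

Lemma has_walk1 x y : has_walk x y 1 -> adj x y.
Proof. by case/has_walkP=> -[|a [|b p]] [] //= /andP[+ _] <-. Qed.

Lemma has_walk2 x y : has_walk x y 2 -> exists2 a, adj x a & adj a y.
Proof.
case/has_walkP=> -[|a [|b [|c p]]] [] //= /and3P[xa ab _] <- _.
by exists a.
Qed.

Lemma geodesic_min x y p :
  path (@adj G) x p -> last x p = y ->
  (forall m, has_walk x y m -> size p <= m) -> geodesic x y p.
Proof.
move=> pp lp minp; rewrite /geodesic pp lp eqxx /=.
by apply/dist_someP; split=> //; apply/has_walkP; exists p.
Qed.

(** Distinct nonadjacent vertices with a common neighbour are at distance two, so [x], [z], [y] is a
    geodesic. *)
Lemma convex_mid2 C x y z :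
  convex C -> x \in C -> y \in C -> x != y -> ~~ adj x y ->
  adj x z -> adj z y -> z \in C.
Proof.
move=> cC xC yC nxy nadj xz zy; apply: (convex_interval cC xC yC).
apply/intervalP; constructor 3; exists [:: z; y]; last by rewrite !inE eqxx orbT.
apply: geodesic_min => [||[|[|m]]] //=; first by rewrite xz zy.
  by move/has_walk0 => exy; rewrite exy eqxx in nxy.
by move/has_walk1 => axy; rewrite axy in nadj.
Qed.

(** Walks of length 0, 1 and 2 are all excluded, so the path through [a] and [b] is a geodesic. *)
Lemma convex_mid3 C x y a b :
  convex C -> x \in C -> y \in C -> x != y -> ~~ adj x y ->
  (forall z, adj x z -> ~~ adj z y) ->
  adj x a -> adj a b -> adj b y -> (a \in C) && (b \in C).
Proof.
move=> cC xC yC nxy nadj ncom xa ab b_y.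
have gp : geodesic x y [:: a; b; y].
  apply: geodesic_min => [||[|[|[|m]]]] //=; first by rewrite xa ab b_y.
  - by move/has_walk0 => exy; rewrite exy eqxx in nxy.
  - by move/has_walk1 => axy; rewrite axy in nadj.
  by case/has_walk2=> z /ncom/negbTE->.
by apply/andP; split; apply: (convex_interval cC xC yC); apply/intervalP;
  constructor 3; exists [:: a; b; y]; rewrite // !inE eqxx ?orbT.
Qed.

Lemma sub_hull_set S C : hull_set S -> convex C -> S \subset C -> C = [set: G].
Proof.
move=> /eqP hS cC SC; apply/eqP; rewrite -subTset -hS.
by apply: bigcap_inf; rewrite cC.
Qed.

Lemma hull_setI S :
  (forall C, convex C -> S \subset C -> C = [set: G]) -> hull_set S.
Proof.
move=> SP; rewrite /hull_set -subTset; apply/bigcapsP=> C /andP[cC SC].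
by rewrite (SP C).
Qed.

(** The empty set is convex, so it is its own hull and misses [x]. *)
Lemma hull_set_neq0 S x : hull_set S -> S != set0.
Proof.
move=> hS; apply: contraT; rewrite negbK => /eqP S0.
have c0 : convex (set0 : {set G}) by apply: convexI => ? ? ?; rewrite inE.
have := in_setT x; rewrite -(sub_hull_set hS c0) ?inE //.
by rewrite S0 sub0set.
Qed.

Lemma hull_number_le S : hull_set S -> hull_number G <= #|S|.
Proof.
move=> hS; rewrite /hull_number.
by case: arg_minnP => [|T _ +]; [apply: hull_set_setT | apply].
Qed.

Lemma hull_number_attained : exists2 S : {set G}, hull_set S & hull_number G = #|S|.
Proof.
rewrite /hull_number; case: arg_minnP; first exact: hull_set_setT.
by move=> S hS _; exists S.
Qed.

Lemma diam_leP k x y :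
  diam_le G k -> exists2 n, dist x y == Some n & n <= k.
Proof.
rewrite /diam_le /diam; case: ifP => // /forallP/(_ x)/forallP/(_ y) cxy.
move=> dk; case dxy: (dist x y) => [n|].
  exists n => //; apply: leq_trans dk.
  apply: leq_trans (leq_bigmax x); apply: leq_trans (leq_bigmax y).
  by rewrite dxy.
by move/eqP: dxy; rewrite dist_noneP cxy.
Qed.

(** A partial converse of [convex_mid2]: in diameter at most 2 a geodesic has at most one inner
    vertex, so closure under midpoints is convexity. *)
Lemma convex_diam2 C :
  diam_le G 2 ->
  (forall x y z, x \in C -> y \in C -> x != y -> ~~ adj x y ->
     adj x z -> adj z y -> z \in C) ->
  convex C.
Proof.
move=> d2 CP; apply: convexI => x y z xC yC /intervalP[->|->|] //.
case=> p /and3P[pp /eqP lp dp].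
have [n dn n2] := diam_leP x y d2.
have sp : size p <= 2 by move: dp; rewrite (eqP dn) => /eqP[<-].
have /dist_someP[_ minp] := dp.
case: p pp lp sp minp {dp} => [|a [|b [|//]]] /=.
- by rewrite inE => _ _ _ _ /eqP->.
- by move=> _ -> _ _; rewrite !inE => /orP[]/eqP->.
case/and3P=> xa ab _ eby _ minp; rewrite eby in ab *.
rewrite !inE => /or3P[] /eqP-> //.
(* Equal or adjacent ends would give a walk shorter than two edges. *)
apply: (CP x y a) => //; apply/negP.
  move/eqP=> exy; suff /minp : has_walk x y 0 by [].
  by apply/has_walkP; exists [::].
move=> axy; suff /minp : has_walk x y 1 by [].
by apply/has_walkP; exists [:: y]; rewrite /= axy.
Qed.

End Convexity.

(** * Vertices outside the nontrivial component *)

Section OneNontrivialComponent.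
Variables (G : sgraph) (V1 : {set G}).
Hypothesis one_nontrivial : nontrivial_components G = [set V1].

Let comp_in x : [set y in [set: G] | connect (@adj G) x y] \in components G.
Proof. by apply/imsetP; exists x. Qed.

Let V1_nontrivial : V1 \in nontrivial_components G.
Proof. by rewrite one_nontrivial inE. Qed.

Lemma nontrivial_component_neq0 : exists x, x \in V1.
Proof.
move: V1_nontrivial; rewrite inE => /andP[/imsetP[x _ ->] _].
by exists x; rewrite !inE connect0.
Qed.

Lemma nontrivial_component_connect x y :
  x \in V1 -> y \in V1 -> connect (@adj G) x y.
Proof.
move: V1_nontrivial; rewrite inE => /andP[/imsetP[z _ ->] _].
rewrite !inE /= => zx; apply: connect_trans.
by rewrite (sym_connect_sym (@adj_sym G)).
Qed.

Lemma component_notin x :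
  x \notin V1 -> [set y in [set: G] | connect (@adj G) x y] = [set x].
Proof.
move=> xV1; set C := [set y in _ | _].
have xC : x \in C by rewrite !inE connect0.
have : C \notin nontrivial_components G.
  by rewrite one_nontrivial inE; apply: contraNneq xV1 => <-.
rewrite inE comp_in /= negbK => /cards1P[z Cz].
by move: xC; rewrite Cz inE => /eqP->.
Qed.

Lemma isolated_notin x y : x \notin V1 -> adj x y = false.
Proof.
move=> xV1; apply/negP=> axy.
have : y \in [set y in [set: G] | connect (@adj G) x y].
  by rewrite !inE connect1.
by rewrite component_notin // inE => /eqP eyx; rewrite eyx adj_irr in axy.
Qed.

(** The map sending [x] to its singleton is injective, and outside [V1] that singleton is a
    component. *)
Lemma card_isolated : #|~: V1| <= #|trivial_components G|.
Proof.
rewrite -(card_imset _ (@set1_inj G)); apply: subset_leq_card.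
apply/subsetP=> _ /imsetP[x + ->]; rewrite !inE => xV1.
by rewrite -{1}(component_notin xV1) comp_in cards1.
Qed.

Lemma isolated_exists : 0 < #|trivial_components G| -> exists u, u \notin V1.
Proof.
case/card_gt0P=> C; rewrite inE => /andP[/imsetP[u _ ->] c1].
(* If [u] were in [V1], its component would be [V1], which is not a singleton. *)
exists u; apply: contraL c1 => uV1.
suff -> : [set y in [set: G] | connect (@adj G) u y] = V1.
  by move: V1_nontrivial; rewrite inE => /andP[].
apply/setP=> y; rewrite !inE /=; apply/idP/idP; last first.
  exact: nontrivial_component_connect.
move=> uy; apply: contraLR uV1 => yV1.
have : u \in [set z in [set: G] | connect (@adj G) y z].
  by rewrite !inE (sym_connect_sym (@adj_sym G)).
by rewrite component_notin // inE => /eqP->.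
Qed.

End OneNontrivialComponent.

(** * Propagation of a convex set through the prism *)

Section PrismConvexSets.
Variables (G : sgraph) (V1 : {set G}) (C : {set cprism G}).
Hypotheses (one_nontrivial : nontrivial_components G = [set V1])
  (diam2 : diam_le (@induced (complement G) V1) 2)
  (convexC : convex C).

Let isolated := isolated_notin one_nontrivial.

(** The trace [D] of [C] on the complement of the component is convex there, since midpoints of
    nonadjacent pairs remain midpoints in the prism. *)
Lemma prism_compl_component (S : {set @induced (complement G) V1}) :
  hull_set S -> (forall s, s \in S -> inr (val s) \in C) ->
  forall x, x \in V1 -> inr x \in C.
Proof.
move=> hS SC x xV1.
pose D := [set z : @induced (complement G) V1 | inr (val z) \in C].
have cD : convex D.
  apply: convex_diam2 diam2 _ => a b z; rewrite !inE => aC bC nab nadj az zb.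
  exact: (convex_mid2 convexC aC bC).
have DT : D = setT.
  by apply: sub_hull_set hS cD _; apply/subsetP=> s sS; rewrite inE SC.
have : (exist _ x xV1 : @induced (complement G) V1) \in D by rewrite DT inE.
by rewrite inE.
Qed.

(** The only neighbour of [inl u] is [inr u], which is not adjacent to [inl s]; hence the distance
    is three, attained through both copies. *)
Lemma prism_copies s u :
  s \in V1 -> u \notin V1 -> inl s \in C -> inl u \in C ->
  (inr s \in C) && (inr u \in C).
Proof.
move=> sV1 uV1 sC uC.
have nsu : s != u by apply: contraNneq uV1 => <-.
apply: (convex_mid3 convexC sC uC) => //=.
- by rewrite adj_sym isolated.
- move=> [z|z] /=; first by rewrite (adj_sym z) (isolated z uV1).
  by move/eqP=> <-.
by rewrite /compl_adj nsu adj_sym isolated.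
Qed.

Lemma prism_isolated_copy s u :
  s \in V1 -> u \notin V1 -> inr s \in C -> inl u \in C -> inr u \in C.
Proof.
move=> sV1 uV1 sC uC; have nsu : s != u by apply: contraNneq uV1 => <-.
apply: (convex_mid2 convexC sC uC) => //=.
by rewrite /compl_adj nsu adj_sym isolated.
Qed.

(** For an edge [x w], the vertex [inl w] is a midpoint of [inl x] and [inr w]; induct along a
    path. *)
Lemma prism_connected x y :
  (forall z, inr z \in C) -> connect (@adj G) x y ->
  inl x \in C -> inl y \in C.
Proof.
move=> rC /connectP[p pp ->]; elim: p x pp => //= w p IHp x /andP[xw pp] xC.
apply: IHp pp _; apply: (convex_mid2 convexC xC (rC w)) => //=.
by apply: contraTneq xw => ->; rewrite adj_irr.
Qed.

End PrismConvexSets.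

Theorem theorem6 (G : sgraph) (V1 : {set G}) (t : nat)
  (Gdisconnected : ~~ connected G)
  (one_nontrivial : nontrivial_components G = [set V1])
  (t_trivial : #|trivial_components G| = t)
  (t_gt0 : 0 < t)
  (diam_G1c : diam_le (@induced (complement G) V1) 2) :
  hull_number (cprism G) <= hull_number (@induced (complement G) V1) + t.
Proof.
have [S hS ->] := hull_number_attained (@induced (complement G) V1).
have [v vV1] := nontrivial_component_neq0 one_nontrivial.
have /set0Pn[s0 s0S] :=
  @hull_set_neq0 (@induced (complement G) V1) S (exist _ v vV1) hS.
have [u uV1] : exists u, u \notin V1.
  by apply: (isolated_exists one_nontrivial); rewrite t_trivial.
pose A : {set cprism G} := [set inr (val s) | s in S :\ s0].
pose B : {set cprism G} := [set inl x | x in ~: V1].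
pose T : {set cprism G} := inl (val s0) |: (A :|: B).
have cardT : #|T| <= #|S| + t.
  (* The vertex [inl (val s0)] pays for [s0], [A] for the rest of [S], and [B] for [t]. *)
  rewrite (cardsD1 s0 S) s0S -addnA (leq_trans (leq_card_setU _ _)) //.
  rewrite cards1 leq_add2l (leq_trans (leq_card_setU _ _)) //.
  rewrite leq_add ?leq_imset_card // (leq_trans (leq_imset_card _ _)) //.
  by rewrite -t_trivial card_isolated.
apply: leq_trans cardT; apply: hull_number_le; apply: hull_setI => C cC.
move/subsetP=> TC.
have s0V1 : val s0 \in V1 by apply: valP.
have s0C : inl (val s0) \in C by apply: TC; rewrite !inE eqxx.
have isoC x : x \notin V1 -> inl x \in C.
  move=> xV1; apply: TC; rewrite !inE; apply/or3P; constructor 3.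
  by apply/imsetP; exists x; rewrite ?inE.
have /andP[s0rC _] := prism_copies one_nontrivial cC s0V1 uV1 s0C (isoC u uV1).
have V1rC : forall x, x \in V1 -> inr x \in C.
  apply: (prism_compl_component diam_G1c cC hS) => s sS.
  (* The copy of [s0] is not put in [T]; it comes from the geodesic to [u]. *)
  have [-> //|ns] := eqVneq s s0; apply: TC; rewrite !inE.
  by apply/or3P; constructor 2; apply/imsetP; exists s; rewrite // !inE ns.
have rC x : inr x \in C.
  have [/V1rC //|xV1] := boolP (x \in V1).
  exact: (prism_isolated_copy one_nontrivial cC s0V1 xV1 s0rC (isoC x xV1)).
apply/setP=> [[x|x]]; rewrite !inE ?rC //.
have [xV1|/isoC //] := boolP (x \in V1).
apply: (prism_connected cC rC) s0C.
exact: (nontrivial_component_connect one_nontrivial).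
Qed.
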